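(* Let $X$ be a topological space, $x\in X$, and let $(U_\alpha)_{\alpha\in\omega^\omega}$ be a neighborhood $\omega^\omega$-base at $x$, i.e. a neighborhood base at $x$ such that $U_\beta\subset U_\alpha$ for all $\alpha\le\beta$ in $\omega^\omega$. For a finite sequence $\beta\in\omega^{<\omega}$ put $U_\beta=\bigcap\{U_\alpha:\alpha\in\omega^\omega,\ \alpha \text{ extends }\beta\}$. Then for every $\alpha\in\omega^\omega$ and every sequence $(x_n)_{n\in\omega}\in X^\omega$ accumulating at $x$ there exists $k\in\omega$ such that the set $U_{\alpha|k}$ contains infinitely many points of the sequence $(x_n)_{n\in\omega}$ (that is, $\{n\in\omega:x_n\in U_{\alpha|k}\}$ is infinite). Consequently, the family $\{U_\beta\}_{\beta\in\omega^{<\omega}}$ is a countable $\mathsf{s}^*$-network at $x$.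
   Context: $\omega^\omega$ is the set of functions $\omega\to\omega$ with the coordinatewise order: $\alpha\le\beta$ iff $\alpha(n)\le\beta(n)$ for all $n$. $\omega^{<\omega}=\bigcup_{n\in\omega}\omega^n$ is the set of finite sequences of natural numbers; $\alpha|k\in\omega^k$ is the restriction of $\alpha$ to $k=\{0,\dots,k-1\}$; a function $\alpha\in\omega^\omega$ extends $\beta\in\omega^n$ if $\alpha|n=\beta$. Neighborhoods need not be open, and no separation axioms are assumed. A sequence $(x_n)_{n\in\omega}$ accumulates at $x$ if every neighborhood of $x$ contains $x_n$ for infinitely many $n$. A set $C\subset X$ accumulates at $x$ if every neighborhood of $x$ contains infinitely many points of $C$. A family $\mathcal N$ of subsets of $X$ is an $\mathsf{s}^*$-network at $x$ if for any neighborhood $O_x$ of $x$ and any countable set $C\subset X$ accumulating at $x$ there is $N\in\mathcal N$ such that $x\in N\subset O_x$ and $N\cap C$ is infinite. *)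

(* Defs.v *)
From mathcomp Require Import all_boot all_order.
From mathcomp Require Import boolp classical_sets functions cardinality filter.
From mathcomp Require Import topology.

Set Implicit Arguments.
Unset Strict Implicit.
Unset Printing Implicit Defensive.

Local Open Scope classical_set_scope.

(* Members of the base are neighborhoods, not necessarily open sets. *)
Definition nbhs_base (X : topologicalType) (x : X) (I : Type)
    (B : I -> set X) : Prop :=
  (forall i, nbhs x (B i)) /\
  (forall O : set X, nbhs x O -> exists i, B i `<=` O).

(* [<=%O] on [nat -> nat] is the pointwise order; see [lefP]. *)
Definition nbhs_omega_base (X : topologicalType) (x : X)
    (U : (nat -> nat) -> set X) : Prop :=
  nbhs_base x U /\
  (forall alpha beta : nat -> nat, (alpha <= beta)%O -> U beta `<=` U alpha).

Definition restr (alpha : nat -> nat) (k : nat) : seq nat := mkseq alpha k.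

Definition extends (alpha : nat -> nat) (beta : seq nat) : Prop :=
  restr alpha (size beta) = beta.

Definition seq_inter (X : Type) (U : (nat -> nat) -> set X)
    (beta : seq nat) : set X :=
  \bigcap_(alpha in [set alpha | extends alpha beta]) U alpha.

(* Counts indices, not distinct values, so a constant sequence accumulates;
   [set_acc_point] counts points. *)
Definition seq_acc_point (X : topologicalType) (u : nat -> X) (x : X) : Prop :=
  forall O : set X, nbhs x O -> infinite_set [set n | O (u n)].

Definition set_acc_point (X : topologicalType) (C : set X) (x : X) : Prop :=
  forall O : set X, nbhs x O -> infinite_set (O `&` C).

Definition s_star_network (X : topologicalType) (x : X)
    (N : set (set X)) : Prop :=
  forall (O C : set X), nbhs x O -> countable C -> set_acc_point C x ->
    exists A : set X, [/\ N A, A x, A `<=` O & infinite_set (A `&` C)].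

(* Main.v *)
Require Import Defs.
From mathcomp Require Import all_boot all_order.
From mathcomp Require Import boolp classical_sets functions cardinality filter.
From mathcomp Require Import topology.

Local Open Scope classical_set_scope.

(** The heart of the matter is a diagonalisation that involves no topology
    ([eventually_outside]). Suppose that every [seq_inter U (restr alpha k)]
    contains [u n] for finitely many [n] only. For all but finitely many [n]
    there is then a largest [k <= n] such that [u n] is outside
    [seq_inter U (restr alpha k)], hence an index [gamma n] that agrees with
    [alpha] below [k] and has [u n] outside [U (gamma n)]. These [k] tend to
    infinity with [n], so at each coordinate [j] all but finitely many of the
    [gamma n] take the value [alpha j]; consequently the [gamma n] have a common
    pointwise upper bound [beta]. As [U] is antitone, [U beta] misses almost all
    [u n], and therefore [u] does not accumulate at a point of which [U beta]
    is a neighborhood.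

    For the network property, an accumulating countable set is infinite, so it
    can be listed without repetition ([enum_infinite_countable]), and the listing
    is an accumulating sequence. Given a neighborhood [O], the first part is
    applied to an [alpha] with [U alpha `<=` O]: all the sets
    [seq_inter U (restr alpha k)] lie between [x] and [U alpha]. *)

Lemma finite_nat_bounded {A : set nat} :
  finite_set A -> exists b, forall n, b <= n -> ~ A n.
Proof.
move=> /finite_seqP[s ->]; exists (\max_(i <- s) i).+1 => n ltn /= sn.
by have := @leq_bigmax_seq _ _ xpredT id n sn isT; rewrite leqNgt ltn.
Qed.

Lemma extends_eq {alpha gamma : nat -> nat} {k j} :
  extends gamma (restr alpha k) -> j < k -> gamma j = alpha j.
Proof.
rewrite /extends /restr size_mkseq => e jk.
by rewrite -(nth_mkseq 0 gamma jk) e nth_mkseq.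
Qed.

Lemma seq_inter_restr_sub {X : Type} (U : (nat -> nat) -> set X) alpha k :
  seq_inter U (restr alpha k) `<=` U alpha.
Proof. by move=> y; apply; rewrite /= /extends /restr size_mkseq. Qed.

(** Functions that agree with [alpha], at each coordinate, from some index on
    take finitely many values there; so the maximum of those values works. *)
Lemma common_upper_bound {alpha : nat -> nat} {gamma : nat -> nat -> nat} :
  (forall j, exists b, forall n, b <= n -> gamma n j = alpha j) ->
  exists beta, forall n, (gamma n <= beta)%O.
Proof.
move=> /choice[b gammaE].
exists (fun j => maxn (alpha j) (\max_(n < b j) gamma n j)) => n.
apply/lefP => j; rewrite leEnat.
have [bn|nb] := leqP (b j) n; first by rewrite gammaE// leq_maxl.
rewrite leq_max; apply/orP; right.
exact: (leq_bigmax (F := fun i : 'I_(b j) => gamma i j) (Ordinal nb)).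
Qed.

(** The largest level [k <= n] whose set misses [y] provides [gamma]; the
    bound by [n] is there because [y] may be missed at every level. *)
Lemma late_witness {X : Type} {U : (nat -> nat) -> set X} {alpha y} n :
  ~ seq_inter U (restr alpha 0) y ->
  exists gamma, ~ U gamma y /\
    forall j, j < n -> ~ seq_inter U (restr alpha j.+1) y ->
      gamma j = alpha j.
Proof.
move=> y0.
pose P k := (k <= n) && `[< ~ seq_inter U (restr alpha k) y >].
have exP : exists k, P k by exists 0; apply/andP; split=> //; apply/asboolP.
have ubP k : P k -> k <= n by case/andP.
case: (ex_maxnP exP ubP) => k /andP[_ /asboolP yk] kmax.
have [gamma [ext ygamma]] :
    exists gamma, extends gamma (restr alpha k) /\ ~ U gamma y.
  apply: contra_notP yk => nex gamma /= ext.
  by apply: contrapT => ygamma; apply: nex; exists gamma.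
exists gamma; split=> // j jn yj; apply: (extends_eq ext).
by apply: kmax; apply/andP; split=> //; apply/asboolP.
Qed.

(** Only finitely many [n] have no witness from [late_witness]; for these the
    choice [gamma n := alpha] keeps the family dominated. *)
Lemma eventually_outside {X : Type} {U : (nat -> nat) -> set X} {alpha}
    {u : nat -> X} :
  (forall beta gamma : nat -> nat, (beta <= gamma)%O -> U gamma `<=` U beta) ->
  (forall k, finite_set [set n | seq_inter U (restr alpha k) (u n)]) ->
  exists beta, finite_set [set n | U beta (u n)].
Proof.
move=> Uanti fin.
have /choice[gamma gammaP] n : exists gamma,
    (~ seq_inter U (restr alpha 0) (u n) -> ~ U gamma (u n)) /\
    forall j, j < n -> ~ seq_inter U (restr alpha j.+1) (u n) ->
      gamma j = alpha j.
  have [in0|out0] := pselect (seq_inter U (restr alpha 0) (u n)).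
    by exists alpha; split.
  by have [gamma [out gammaE]] := late_witness n out0; exists gamma; split.
have [|beta gamma_le] := @common_upper_bound alpha gamma.
  move=> j; have [b out] := finite_nat_bounded (fin j.+1).
  exists (maxn j.+1 b) => n; rewrite geq_max => /andP[jn bn].
  by have [_ gammaE] := gammaP n; exact/gammaE/out.
exists beta; apply: sub_finite_set (fin 0) => n /= Ubeta.
have [out _] := gammaP n; apply: contrapT => /out; apply.
exact: Uanti (gamma_le n) _ Ubeta.
Qed.

Lemma enum_infinite_countable {T : Type} {C : set T} :
  countable C -> infinite_set C ->
  exists u : nat -> T, injective u /\ range u = C.
Proof.
move=> cC /infiniteP iC.
have /card_set_bijP[f [_ finj fsurj]] : (C #= [set: nat])%card.
  by apply/card_eqPle.
have /choice[u uP] n : exists y, C y /\ f y = n.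
  by have [y Cy fy] := fsurj n I; exists y.
exists u; split=> [m n umn|].
  by have [_ <-] := uP m; have [_ <-] := uP n; rewrite umn.
apply/seteqP; split=> [_ [n _ <-]|y Cy]; first by have [] := uP n.
have [Cu fu] := uP (f y); exists (f y) => //.
by apply: finj; rewrite ?inE.
Qed.

Lemma infinite_preimage_injective {T : Type} {u : nat -> T} {A : set T} :
  injective u ->
  infinite_set [set n | A (u n)] <-> infinite_set (A `&` range u).
Proof.
move=> uinj; have -> : A `&` range u = u @` [set n | A (u n)].
  apply/seteqP; split=> [y [Ay [n _ un]]|_ [n Aun <-]].
    by exists n; rewrite //= un.
  by split=> //; exists n.
by rewrite (eq_finite_set (inj_card_eq (in2W uinj))).
Qed.

Theorem theorem4p1 (X : topologicalType) (x : X)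
    (U : (nat -> nat) -> set X) (hU : nbhs_omega_base x U) :
  (forall (alpha : nat -> nat) (u : nat -> X), seq_acc_point u x ->
     exists k : nat, infinite_set [set n | seq_inter U (restr alpha k) (u n)])
  /\ (countable (range (seq_inter U)) /\
      s_star_network x (range (seq_inter U))).
Proof.
have [[Unbhs Ubase] Uanti] := hU.
have main (alpha : nat -> nat) (u : nat -> X) : seq_acc_point u x ->
    exists k, infinite_set [set n | seq_inter U (restr alpha k) (u n)].
  move=> uacc; apply: contrapT => nex.
  have fin k : finite_set [set n | seq_inter U (restr alpha k) (u n)].
    by apply: contrapT => inf; apply: nex; exists k.
  have [beta fin_beta] := eventually_outside Uanti fin.
  exact: uacc (Unbhs beta) fin_beta.
split=> //; split.
  exact: sub_countable (card_image_le _ _) (countableP _).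
move=> O C Onbhs cC Cacc.
have iC : infinite_set C by rewrite -(setTI C); exact: Cacc filterT.
have [u [uinj uC]] := enum_infinite_countable cC iC.
have uacc : seq_acc_point u x.
  by move=> V /Cacc; rewrite -uC => /(infinite_preimage_injective uinj).
have [alpha alphaO] := Ubase _ Onbhs.
have [k /(infinite_preimage_injective uinj) inf] := main alpha u uacc.
exists (seq_inter U (restr alpha k)); split.
- by exists (restr alpha k).
- by move=> gamma _; exact: nbhs_singleton.
- exact: subset_trans (seq_inter_restr_sub U alpha k) alphaO.
- by rewrite -uC.
Qed.
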